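(* Let $X$ be a Banach space over $\mathbb{K}\in\{\mathbb{R},\mathbb{C}\}$ and let $\tau$ be an admissible topology on $X$. Let $\gamma_0,\gamma_1,\gamma_2,\dots:\Omega\to\{-1,+1\}$ be independent, symmetric random variables on a probability space $(\Omega,\mathcal{F},\mathbb{P})$, and let $\{x_n\}_{n=0}^\infty\subseteq X$. The following are equivalent: (I) for $\mathbb{P}$-almost all $\omega\in\Omega$, $\sum_{n=0}^\infty\gamma_n(\omega)x_n$ is summable in $X$ (in the norm topology); (II) for $\mathbb{P}$-almost all $\omega\in\Omega$, $\sum_{n=0}^\infty\gamma_n(\omega)x_n$ is $\tau$-summable. Moreover, whether or not these conditions hold depends only on $\{x_n\}_{n=0}^\infty$ and the laws of each of $\gamma_0,\gamma_1,\gamma_2,\dots$.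
   Context: A topology $\tau$ on a Banach space $X$ is called admissible if (1) it is a Hausdorff locally convex topological vector space topology on $X$, identical to or weaker than the norm topology, under which the norm-closed unit ball $\mathbb{B}=\{x\in X:\|x\|\le 1\}$ is $\tau$-closed; and (2) if $X$ is not separable, then $\tau$ is at least as strong as the weak topology of $X$. A formal series $\sum_{n=0}^\infty y_n$ with terms in $X$ is summable (resp. $\tau$-summable) if its partial sums $\sum_{n=0}^N y_n$ converge in norm (resp. in $(X,\tau)$) to an element of $X$ as $N\to\infty$. A random variable $\gamma$ is symmetric if $\gamma$ and $-\gamma$ have the same law. A property holds for $\mathbb{P}$-almost all $\omega$ if there is $F\in\mathcal{F}$ with $\mathbb{P}(F)=1$ such that it holds for every $\omega\in F$ (the set where the property holds is not itself required to be measurable). *)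

(* Defs.v *)
From HB Require Import structures.
From mathcomp Require Import all_boot all_order all_algebra.
From mathcomp Require Import finmap complex.
From mathcomp Require Import all_classical all_reals all_analysis measurable_realfun.

Set Implicit Arguments.
Unset Strict Implicit.
Unset Printing Implicit Defensive.

Import Order.TTheory GRing.Theory Num.Theory.
Import numFieldTopology.Exports numFieldNormedType.Exports.

Local Open Scope classical_set_scope.
Local Open Scope ring_scope.

Variant scalar_kind := RealScalars | ComplexScalars.

Definition scalars (R : realType) (k : scalar_kind) : numFieldType :=
  match k with
  | RealScalars => R
  | ComplexScalars => R[i]
  end.

Definition real_scalar (R : realType) (k : scalar_kind) : R -> scalars R k :=
  match k return R -> scalars R k with
  | RealScalars => fun r => r
  | ComplexScalars => fun r => r%:C%C
  end.

Record topology_on (X : Type) := TopologyOn {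
  opens : set_system X;
  opensT : opens setT;
  opensI : setI_closed opens;
  opens_bigcup : forall (I : Type) (f : I -> set X),
    (forall i, opens (f i)) -> opens (\bigcup_i f i)
}.

(* A copy of X that keeps its algebraic structure but whose topology is tau
   instead of the one attached to X. *)
Definition retopologize (X : Type) (tau : topology_on X) : Type := X.

HB.instance Definition _ (X : choiceType) (tau : topology_on X) :=
  Choice.on (retopologize tau).
HB.instance Definition _ (X : choiceType) (tau : topology_on X) :=
  isOpenTopological.Build (retopologize tau)
    (opensT tau) (@opensI _ tau) (@opens_bigcup _ tau).
HB.instance Definition _ (K : numFieldType) (X : lmodType K)
  (tau : topology_on X) := GRing.Lmodule.on (retopologize tau).

Section admissible_topologies.
Context (K : numFieldType).

(* The fields are those of the factory PreTopologicalLmod_isTvs. *)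
Definition locally_convex_tvs (E : preTopologicalLmodType K) : Prop :=
  [/\ continuous (fun z : E * E => z.1 + z.2),
      continuous (fun z : K^o * E => z.1 *: z.2) &
      exists2 B : set_system E, (forall b, b \in B -> convex_set b) & basis B].

Definition separable (T : topologicalType) : Prop :=
  exists2 D : set T, countable D & dense D.

Definition dual (X : normedModType K) : Type :=
  {f : {linear X -> K^o} | continuous f}.

Definition weak_topology (X : normedModType K) : Type :=
  sup_topology (fun f : dual X =>
    Topological.on (initial_topology (sval f : X -> K^o))).

HB.instance Definition _ (X : normedModType K) :=
  Topological.on (weak_topology X).

Definition admissible (X : normedModType K) (tau : topology_on X) : Prop :=
  let Xtau := retopologize tau in
  [/\ hausdorff_space Xtau,
      locally_convex_tvs Xtau,
      (forall A : set X, open (A : set Xtau) -> open A),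
      closed ([set x : X | `|x| <= 1] : set Xtau) &
      ~ separable X ->
      forall A : set X, open (A : set (weak_topology X)) ->
        open (A : set Xtau)].

Definition summable_series (E : preTopologicalLmodType K) (y : nat -> E) :
    Prop :=
  exists s : E, (fun N => \sum_(0 <= n < N.+1) y n) @ \oo --> s.

End admissible_topologies.

Section random_signs.
Context (R : realType).

Definition same_law d d' (Om : measurableType d) (Om' : measurableType d')
    (P : probability Om R) (X : {mfun Om >-> R})
    (P' : probability Om' R) (X' : {mfun Om' >-> R}) : Prop :=
  forall A : set R, measurable A -> distribution P X A = distribution P' X' A.

Context d (Om : measurableType d) (P : probability Om R).

Definition symmetric_rv (X : {mfun Om >-> R}) : Prop :=
  same_law P X P (\- X : {mfun Om >-> R}).

Definition independent_rvs (X : nat -> {mfun Om >-> R}) : Prop :=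
  forall (J : {fset nat}) (A : nat -> set R),
    (forall n, n \in J -> measurable (A n)) ->
    P (\bigcap_(n in [set` J]) (X n @^-1` A n)) =
    (\prod_(n <- J) P (X n @^-1` A n))%E.

Definition ae_summable (k : scalar_kind) (gamma : nat -> {mfun Om >-> R})
    (E : preTopologicalLmodType (scalars R k)) (x : nat -> E) : Prop :=
  \forall w \ae P,
    summable_series (fun n => real_scalar k (gamma n w) *: x n).

End random_signs.

(* Main.v *)
Require Import Defs.
From HB Require Import structures.
From mathcomp Require Import all_boot all_order all_algebra.
From mathcomp Require Import finmap complex.
From mathcomp Require Import all_classical all_reals all_analysis.
From mathcomp Require Import measurable_realfun ring lra.

Import Order.TTheory GRing.Theory Num.Theory.
Import numFieldTopology.Exports numFieldNormedType.Exports.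

Local Open Scope classical_set_scope.
Local Open Scope ring_scope.

(** Why the theorem is true.

    Write S_n for the partial sums of the signed series. Norm convergence
    always gives tau-convergence, since tau is weaker than the norm topology.
    Everything else is about the converse, an instance of the Ito-Nisio
    theorem, and about the fact that the event of norm divergence is a
    measurable function of the signs alone.

    All probability is moved to the space of sign sequences. Its sigma-algebra
    is generated by the sets of sequences with a given finite prefix, and the
    law of independent symmetric signs gives mass 2^-n to every prefix of
    length n. The prefix sets are stable under intersection, so such a law is
    unique (fair_unique). Two consequences are used: the law is invariant under
    flipping any fixed set of signs (fair_flip), and the probability of norm
    divergence, which is the measurable set diverges, is the same for all
    families of independent symmetric signs. The second point is the last
    assertion of the theorem once the equivalence (I) <-> (II) is known.

    The set of sign sequences whose series is tau-summable need not be
    measurable. What survives of hypothesis (II) is that every measurable set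
    disjoint from it is null (full). Measurable inequalities can then be checked
    on the tau-summable sequences only (full_le).

    Let s be the tau-sum. It lies in the norm closure of a countable set D
    (separable_hull): if X is separable this is clear, and otherwise
    tau-convergence implies weak convergence and the Hahn-Banach theorem puts s
    in the closed real span of the x_n (weak_limit_in_span). Closed norm balls
    are tau-closed, and a topological vector space is regular; covering the
    complement of a ball, near D, by countably many tau-open sets whose
    tau-closures miss the ball shows that the event that s - S_N lies outside a
    given ball agrees, on tau-summable sequences, with a measurable set
    (outside_event). No measurability of the map that sends the signs to s is
    needed for this.

    Next comes the symmetrisation (tail_small). Up to a small probability s is
    within r of one of finitely many points of D. Flipping all signs from N on
    turns s into 2 S_N - s and preserves the law, so 2 S_N - s is also
    within r of one of these points. Hence s - S_N, half the difference, is
    within r of a finite set Z of points that does not depend on N. As s - S_N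
    tends to 0 in tau and the ball of radius r about a point z of Z with
    |z| > 2r is tau-closed and misses 0, such z are eventually avoided. So
    |s - S_N| <= 3r off an event of small probability, for some N.

    Finally Levy's reflection argument (levy_tail) bounds the probability that
    some later S_n is farther than e from S_N by twice the probability that
    |s - S_N| > e. Letting the latter go to 0, the partial sums are almost
    surely Cauchy (null_diverges), and X is complete. *)

Set Implicit Arguments.
Unset Strict Implicit.
Unset Printing Implicit Defensive.

(** * The law of independent symmetric signs *)

Definition prefix_cyl (n : nat) (a : nat -> bool) : set (nat -> bool) :=
  [set b | forall i, (i < n)%N -> b i = a i].

(** The empty set is included to make the family stable under
    intersection. *)
Definition prefix_cyls : set (set (nat -> bool)) :=
  [set A | A = set0 \/ exists n a, A = prefix_cyl n a].

Definition sign_seq := g_sigma_algebraType prefix_cyls.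

Definition flip (e : nat -> bool) (b : sign_seq) : sign_seq :=
  fun n => b n (+) e n.

Definition determined (n : nat) (Q : set (nat -> bool)) :=
  forall b b', (forall i, (i < n)%N -> b i = b' i) -> Q b -> Q b'.

Lemma setI_prefix_cyls : setI_closed prefix_cyls.
Proof.
move=> A B [->|[n [a ->]]]; first by rewrite set0I; left.
case=> [->|[m [a' ->]]]; first by rewrite setI0; left.
have [ne|/set0P/negP/negPn/eqP] :=
  pselect ((prefix_cyl n a `&` prefix_cyl m a') !=set0);
  last by move=> ->; left.
case: ne => c [ca ca']; right; exists (maxn n m), c.
apply/seteqP; split => b /=.
  move=> [ba ba'] i; rewrite leq_max => /orP[im|im].
    by rewrite ba// ca.
  by rewrite ba'// ca'.
move=> bc; split => i im.
  by rewrite bc ?ca// leq_max im.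
by rewrite bc ?ca'// leq_max im orbT.
Qed.

Lemma measurable_prefix_cyl n a :
  measurable (prefix_cyl n a : set sign_seq).
Proof. by apply: sub_sigma_algebra; right; exists n, a. Qed.

Section fair.
Context {R : realType}.
Implicit Types mu nu : probability sign_seq R.

Definition fair (mu : set sign_seq -> \bar R) :=
  forall n a, mu (prefix_cyl n a) = (2^-1 ^+ n)%:E.

(** The prefix sets form a pi-system that generates the sigma-algebra. *)
Lemma fair_unique mu nu : fair mu -> fair nu ->
  forall A, measurable A -> mu A = nu A.
Proof.
move=> fmu fnu A mA.
apply: (@measure_unique _ R sign_seq prefix_cyls (fun=> setT)) => //.
- exact: setI_prefix_cyls.
- move=> _; right; exists 0%N, (fun=> true); apply/esym/seteqP; split=> //.
- by apply/seteqP; split => // b _; exists 0%N.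
- move=> _ [->|[n [a ->]]]; rewrite ?measure0//.
  exact: etrans (fmu n a) (esym (fnu n a)).
- by move=> _; exact: le_lt_trans (probability_le1 mu measurableT) (ltry _).
Qed.

End fair.

(** Induction on the number of free coordinates: fixing the first free one to
    each of its two values splits the set in two. *)
Lemma determined_measurable n Q : determined n Q ->
  measurable (Q : set sign_seq).
Proof.
pose ext (s : seq bool) : nat -> bool := nth false s.
have H (s : seq bool) : determined (n + size s) Q ->
   measurable (Q `&` prefix_cyl (size s) (ext s) : set sign_seq).
  elim: n s => [|m IH] s dQ.
    rewrite add0n in dQ.
    have [Qs|nQs] := pselect (Q (ext s)).
      rewrite (_ : _ `&` _ = prefix_cyl (size s) (ext s)).
        exact: measurable_prefix_cyl.
      apply/seteqP; split=> [b []//|b bs]; split => //.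
      by apply: dQ Qs => i /bs.
    rewrite (_ : _ `&` _ = set0); first exact: measurable0.
    apply/seteqP; split => // b [Qb bs]; apply: nQs.
    by apply: dQ Qb.
  have -> : Q `&` prefix_cyl (size s) (ext s) =
     (Q `&` prefix_cyl (size (rcons s true)) (ext (rcons s true))) `|`
     (Q `&` prefix_cyl (size (rcons s false)) (ext (rcons s false))).
    rewrite -setIUr; congr (_ `&` _); rewrite !size_rcons.
    apply/seteqP; split=> b.
      move=> bs; case E : (b (size s)); [left|right] => i;
        rewrite ltnS leq_eqVlt /ext nth_rcons => /orP[/eqP ->|im];
        by rewrite ?ltnn ?eqxx ?im ?E ?bs.
    move=> [] bs i im; move: (bs i (leqW im)); by rewrite /ext nth_rcons im.
  by apply: measurableU; apply: IH; rewrite size_rcons addnS -addSn.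
have := H [::]; rewrite addn0 => /[apply].
by rewrite (_ : _ `&` _ = Q)//; apply/seteqP; split=> [b []|].
Qed.

Lemma flip_prefix_cyl e n a :
  flip e @^-1` prefix_cyl n a = prefix_cyl n (flip e a).
Proof.
apply/seteqP; split => b /= ba i im.
  by rewrite /flip -(ba i im) /flip addbK.
by rewrite /flip (ba i im) /flip addbK.
Qed.

Lemma measurable_flip e : measurable_fun [set: sign_seq] (flip e).
Proof.
apply: (@measurability _ _ sign_seq sign_seq setT (flip e) prefix_cyls) => //.
move=> _ [A [->|[n [a ->]]] <-]; rewrite setTI.
  by rewrite preimage_set0.
by rewrite flip_prefix_cyl; exact: measurable_prefix_cyl.
Qed.

Section fair_maps.
Context {R : realType}.

(** A flip permutes the prefix sets of each length. *)
Lemma fair_flip (mu : probability sign_seq R) e A : fair mu -> measurable A ->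
  mu (flip e @^-1` A) = mu A.
Proof.
move=> fmu mA.
pose fl : {mfun sign_seq >-> sign_seq} :=
  HB.pack (flip e) (isMeasurableFun.Build _ _ _ _ (flip e) (measurable_flip e)).
have ffl : fair (distribution mu fl).
  by move=> n a; rewrite -(fmu n (flip e a)) -flip_prefix_cyl.
exact: (fair_unique ffl fmu).
Qed.

Context d (Om : measurableType d) (P : probability Om R)
    (gamma : nat -> {RV P >-> R}).
Hypothesis gamma_sign : forall n w, gamma n w = -1 \/ gamma n w = 1.
Hypothesis gamma_indep : independent_rvs P gamma.
Hypothesis gamma_sym : forall n, symmetric_rv P (gamma n).

Definition bits (w : Om) : sign_seq := fun n => gamma n w == -1.

Lemma gamma_bits n w : gamma n w = (-1) ^+ bits w n.
Proof.
rewrite /bits; case: eqP => [->//|]; case: (gamma_sign n w) => // ->.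
Qed.

(** The two values have equal probability by symmetry, and the two
    probabilities add up to one. *)
Lemma gamma_half n (t : bool) : P (gamma n @^-1` [set (-1) ^+ t]) = (2^-1)%:E.
Proof.
have E : P (gamma n @^-1` [set -1]) = P (gamma n @^-1` [set 1]).
  have := gamma_sym n (measurable_set1 (-1)).
  rewrite /distribution /pushforward /= => ->.
  congr (P _); apply/seteqP; split => w /=; first by move/oppr_inj.
  by move=> ->.
have m r : measurable (gamma n @^-1` [set r]).
  by rewrite -[X in measurable X]setTI; exact: measurable_funP.
have U : (P (gamma n @^-1` [set (-1)%R]) + P (gamma n @^-1` [set 1%R]) = 1)%E.
  rewrite -(@probability_setT _ _ _ P) -measureU//.
    by congr (P _); apply/seteqP; split => w //= _; exact: gamma_sign.
  apply/seteqP; split => // w [/= -> /eqP].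
  by rewrite eq_sym -subr_eq0 opprK -(natrD _ 1 1) pnatr_eq0.
have -> : P (gamma n @^-1` [set (-1) ^+ t]) = P (gamma n @^-1` [set 1]).
  by case: t => //; rewrite expr1.
move: U; rewrite E => /(congr1 fine).
rewrite -[P _]fineK ?fin_num_measure// -EFinD /= => U.
congr EFin; apply: (mulIf (_ : 2 != 0)) => //.
by rewrite mulVf ?mulr2 // mulr_natr mulr2n.
Qed.

Lemma bits_prefix_cyl n a : bits @^-1` prefix_cyl n a =
  \bigcap_(i in [set` [fset i in iota 0 n]%fset])
    (gamma i @^-1` [set (-1) ^+ a i]).
Proof.
apply/seteqP; split => w /= ba i.
  by rewrite /= !inE mem_iota add0n /= => im; rewrite /= gamma_bits ba.
move=> im; have := ba i; rewrite /= !inE mem_iota add0n /= => /(_ im).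
rewrite gamma_bits; case: (bits w i); case: (a i) => //= /eqP.
  by rewrite eq_sym -subr_eq0 opprK -(natrD _ 1 1) pnatr_eq0.
by rewrite -subr_eq0 opprK -(natrD _ 1 1) pnatr_eq0.
Qed.

Lemma measurable_bits : measurable_fun [set: Om] bits.
Proof.
apply: (@measurability _ _ Om sign_seq setT bits prefix_cyls) => //.
move=> _ [A [->|[n [a ->]]] <-]; rewrite setTI.
  by rewrite preimage_set0.
rewrite bits_prefix_cyl; apply: fin_bigcap_measurable => // i _.
Qed.

(** The passage from the given random variables to sign sequences. From here
    on only the fair law on sign sequences matters. *)
Lemma fair_law_of_bits : exists mu : probability sign_seq R,
  fair mu /\ forall A, measurable A -> mu A = P (bits @^-1` A).
Proof.
pose bits_mfun : {mfun Om >-> sign_seq} :=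
  HB.pack bits (isMeasurableFun.Build _ _ _ _ bits measurable_bits).
exists (distribution P bits_mfun); split => // n a.
change (P (bits @^-1` prefix_cyl n a) = (2^-1 ^+ n)%:E).
rewrite bits_prefix_cyl gamma_indep//.
rewrite (eq_bigr (fun=> (2^-1)%:E)); last by move=> i _; exact: gamma_half.
rewrite prodEFin big_const_seq count_predT -Monoid.iteropE.
have -> : size [fset i in iota 0 n]%fset = n.
  by rewrite card_imfset//= undup_id ?iota_uniq// size_iota.
done.
Qed.

End fair_maps.

(** * Sets of full outer measure *)

Section full.
Context {R : realType} (mu : probability sign_seq R).

(** Outer measure one, stated through measurable null sets because the sets
    of interest are not known to be measurable. *)
Definition full (A : set sign_seq) :=
  forall M, measurable M -> (forall b, A b -> ~ M b) -> mu M = 0.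

Variables (A : set sign_seq) (fullA : full A).

(** The part of M outside N is disjoint from A, hence null. *)
Lemma full_le M N : measurable M -> measurable N ->
  (forall b, A b -> M b -> N b) -> (mu M <= mu N)%E.
Proof.
move=> mM mN MN.
have -> : (mu M = mu (M `\` N) + mu (M `&` N))%E by exact: measureDI.
have -> : mu (M `\` N) = 0%E.
  apply: fullA; first exact: measurableD.
  by move=> b Ab [Mb]; apply; exact: MN.
rewrite add0e; apply: le_measure; rewrite ?inE//; first exact: measurableI.
Qed.

(** Continuity from above, where the intersection is only known to be empty
    on A. *)
Lemma full_cvg0 (F : nat -> set sign_seq) (delta : R) :
  (forall n, measurable (F n)) ->
  (forall m n, (m <= n)%N -> F n `<=` F m) ->
  (forall b, A b -> exists n, ~ F n b) -> 0 < delta ->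
  exists n, (mu (F n) <= delta%:E)%E.
Proof.
move=> mF niF capF d0.
have mcap : measurable (\bigcap_n F n) by exact: bigcapT_measurable.
have : mu \o F @ \oo --> mu (\bigcap_n F n).
  apply: nonincreasing_cvg_mu => //.
    exact: le_lt_trans (probability_le1 mu (mF 0%N)) (ltry _).
  by move=> m n mn; apply/subsetPset; exact: niF.
have -> : mu (\bigcap_n F n) = 0%:E.
  by apply: fullA => // b /capF[n nF] /(_ n I).
move=> /fine_cvgP[_ /cvgrPdist_lt/(_ _ d0)[n _ /(_ n (leqnn n))]] /=.
rewrite sub0r normrN => /ltW h; exists n.
rewrite -[mu _]fineK ?fin_num_measure// lee_fin.
exact: le_trans (ler_norm _) h.
Qed.

End full.

(** * Topological vector spaces without a uniform structure *)

Section tvs.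
Context (K : numFieldType) (E : preTopologicalLmodType K).
Hypothesis tvsE : locally_convex_tvs E.

Lemma tvs_cvgD (T : Type) (F : set_system T) {FF : Filter F}
    (f g : T -> E) a b :
  f @ F --> a -> g @ F --> b -> (fun t => f t + g t) @ F --> a + b.
Proof.
move=> fa gb; case: tvsE => + _ _ => /(_ (a, b)) addc.
exact: (cvg_comp (fun t => (f t, g t)) (fun z : E * E => z.1 + z.2)
  (cvg_pair fa gb) addc).
Qed.

Lemma tvs_cvgZ (T : Type) (F : set_system T) {FF : Filter F} (f : T -> E) c a :
  f @ F --> a -> (fun t => c *: f t) @ F --> c *: a.
Proof.
move=> fa; case: tvsE => _ + _ => /(_ (c, a)) scc.
apply: (cvg_comp (fun t => (c : K^o, f t))
  (fun z : K^o * E => z.1 *: z.2) _ scc).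
exact: (cvg_pair (@cvg_cst K^o c _ F _) fa).
Qed.

Lemma tvs_cvgN (T : Type) (F : set_system T) {FF : Filter F} (f : T -> E) a :
  f @ F --> a -> (fun t => - f t) @ F --> - a.
Proof.
move=> /tvs_cvgZ-/(_ (-1)); rewrite scaleN1r.
by under eq_fun do rewrite scaleN1r.
Qed.

(** If a difference of a point near y and a point near 0 stays in W, then a
    point c of the closure of U is such a difference: c = u - (u - c) with u in
    U close to c. *)
Lemma tvs_regular (W : set E) (y : E) : open W -> W y ->
  exists U : set E, [/\ open U, U y & closure U `<=` W].
Proof.
move=> oW Wy.
have /(_ W) : (fun z : E * E => z.1 - z.2) @ nbhs (y, 0 : E) --> y - 0.
  by apply: tvs_cvgD; [exact: cvg_fst|apply: tvs_cvgN; exact: cvg_snd].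
rewrite subr0 => /(_ (open_nbhs_nbhs (conj oW Wy)))[[/= A B] [nA nB] AB].
exists A^°; split; [exact: open_interior|exact: nA|].
move=> c; have /(_ B) : (fun u : E => u - c) @ nbhs c --> 0.
  by rewrite -(subrr c); apply: tvs_cvgD; [exact: cvg_id|exact: cvg_cst].
move=> /(_ nB) nc /(_ _ nc)[u [/interior_subset Au Bu]].
by have := AB (u, u - c) (conj Au Bu); rewrite /= opprB addrC subrK.
Qed.

Lemma tvs_closed_affine (A : set E) (z : E) (c : K) : closed A ->
  closed [set y | A (c *: (y - z))].
Proof.
apply: preimage_closed => y _; apply: tvs_cvgZ.
by apply: tvs_cvgD; [exact: cvg_id|exact: cvg_cst].
Qed.

Lemma tvs_cvgB_cst (u : nat -> E) (s c : E) :
  u @ \oo --> s -> (fun n => u n - c) @ \oo --> s - c.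
Proof. by move=> us; apply: tvs_cvgD => //; exact: cvg_cst. Qed.

Lemma tvs_cvg_cstB (u : nat -> E) (s c : E) :
  u @ \oo --> s -> (fun n => c - u n) @ \oo --> c - s.
Proof. by move=> us; apply: tvs_cvgD; [exact: cvg_cst|exact: tvs_cvgN]. Qed.

Lemma tvs_cvg_remainder (u : nat -> E) (s : E) :
  u @ \oo --> s -> (fun n => s - u n) @ \oo --> (0 : E).
Proof. by move=> /(@tvs_cvg_cstB _ _ s); rewrite subrr. Qed.

End tvs.

(** * Exhausting tau-open sets by countably many tau-closed pieces *)

Section exhaustion.
Context (K : numFieldType) (X : normedModType K) (tau : topology_on X).
Hypothesis archK : forall e : K, 0 < e -> exists n, n.+1%:R^-1 < e.
Local Notation Xtau := (retopologize tau).
Hypothesis tvs_tau : locally_convex_tvs Xtau.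
Hypothesis tau_weaker : forall A : set X, open (A : set Xtau) -> open A.
Hypothesis tau_ball : closed ([set x : X | `|x| <= 1] : set Xtau).

Lemma tau_closed_ball (z : X) (r : K) : 0 < r ->
  closed ([set y : X | `|y - z| <= r] : set Xtau).
Proof.
move=> r0; have := tvs_closed_affine tvs_tau (z := z) (c := r^-1) tau_ball.
congr closed; apply/seteqP; split => y /=;
  by rewrite normrZ gtr0_norm ?invr_gt0// ler_pdivrMl// mulr1.
Qed.

(** The Lindelof property of the separable set closure (range D), applied to
    the cover of W by the tau-open sets provided by regularity. Each U p is
    chosen to contain the norm ball of radius 1 / (p.2 + 1) around D p.1,
    whenever such a set exists; this makes the cover countable. With U p open
    and its closure inside W, a tau-convergent sequence with limit in
    closure (range D) has its limit in W if and only if it is eventually in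
    some U p. *)
Lemma tau_exhaustion (D : nat -> X) (W : set X) : open (W : set Xtau) ->
  exists U : nat * nat -> set X,
    [/\ forall p, open (U p : set Xtau),
        forall p, closure (U p : set Xtau) `<=` W &
        forall y, W y -> closure (range D) y -> exists p, U p y].
Proof.
move=> oW.
pose P (p : nat * nat) (V : set X) :=
  [/\ open (V : set Xtau), closure (V : set Xtau) `<=` W &
   forall y, `|D p.1 - y| < p.2.+1%:R^-1 -> V y].
have /choice[U HU] : forall p, exists V : set X, open (V : set Xtau) /\
    closure (V : set Xtau) `<=` W /\ ((exists V', P p V') -> P p V).
  move=> p; have [[V PV]|nV] := pselect (exists V, P p V).
    by exists V; case: (PV).
  exists set0; split; first exact: open0.
  by rewrite closure0; split=> [y []|/nV].
exists U; split=> [p|p|y Wy yD]; [by case: (HU p)|by case: (HU p) => _ []|].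
have [V [oV Vy VW]] := tvs_regular tvs_tau oW Wy.
have /nbhs_ballP[e /= e0 eV] : nbhs y (V : set X).
  by apply: open_nbhs_nbhs; split => //; exact: tau_weaker.
have [n ne] := archK (divr_gt0 e0 (ltr0n _ 2)).
have n0 : (0 : K) < n.+1%:R^-1 by rewrite invr_gt0 ltr0n.
have [_ [[i _ <-]]] := yD _ (nbhsx_ballx y _ n0); rewrite -ball_normE /= => yi.
exists (i, n); case: (HU (i, n)) => _ [_ []] /=.
  exists V; split => // z /= iz; apply: eV; rewrite -ball_normE /=.
  rewrite (splitr e) -(subrK (D i) y) -addrA.
  rewrite (le_lt_trans (ler_normD _ _))// ltrD//; exact: lt_trans ne.
by move=> _ _; apply; rewrite distrC.
Qed.

End exhaustion.

(** * Partial sums and the Levy inequality *)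

Section partial_sums.
Context (K : numFieldType) (X : lmodType K) (x : nat -> X).

Definition psum (b : sign_seq) (n : nat) : X :=
  \sum_(0 <= i < n) (-1) ^+ b i *: x i.

(** As a mask for flip, this reflects the walk of partial sums at time m. *)
Definition from (m : nat) : nat -> bool := fun n => (m <= n)%N.

Lemma eq_psum b b' n :
  (forall i, (i < n)%N -> b i = b' i) -> psum b n = psum b' n.
Proof. by move=> bb'; apply: eq_big_nat => i /andP[_ im]; rewrite bb'. Qed.

Lemma psum_flip_before m n b : (n <= m)%N ->
  psum (flip (from m) b) n = psum b n.
Proof.
move=> nm; apply: eq_psum => i im.
by rewrite /flip /from leqNgt (leq_trans im nm) addbF.
Qed.

Lemma psum_flip_after m n b : (m <= n)%N ->
  psum (flip (from m) b) n = psum b m - (psum b n - psum b m).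
Proof.
move=> mn; rewrite /psum (big_cat_nat _ (n := m))//=.
rewrite [in RHS](big_cat_nat _ (n := m) (p := n))//=.
rewrite -/(psum _ m) -/(psum _ m) psum_flip_before// [X in _ - X]addrC addKr.
congr (_ + _); rewrite -sumrN; apply: eq_big_nat => i /andP[mi _].
by rewrite /flip /from mi signr_addb mulrN1 scaleNr.
Qed.

Lemma determined_psum n N (U : set X) :
  determined (maxn n N) [set b | U (psum b n - psum b N)].
Proof.
move=> b b' bb'; rewrite /= (eq_psum (b' := b')) 1?(@eq_psum b b' N)//.
  by move=> i im; rewrite bb'// leq_max im orbT.
by move=> i im; rewrite bb'// leq_max im.
Qed.

End partial_sums.

Section levy.
Context (K : numFieldType) (X : normedModType K) (x : nat -> X).

(** Exceeding e is written as a negation because the order of K is only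
    partial; this spares any discussion of which elements of K are real. *)
Definition oscillates (N : nat) (e : K) : set sign_seq :=
  [set b | exists2 n, (N <= n)%N & ~ `|psum x b n - psum x b N| <= e].

Definition first_exit (N : nat) (e : K) (n : nat) : set sign_seq :=
  [set b | [/\ (N <= n)%N, ~ `|psum x b n - psum x b N| <= e &
     forall m, (N <= m < n)%N -> `|psum x b m - psum x b N| <= e]].

Lemma oscillatesE N e : oscillates N e = \bigcup_n first_exit N e n.
Proof.
apply/seteqP; split => b; last by move=> [n _ []]; exists n.
move=> [n Nn bn].
pose P n := `[< (N <= n)%N /\ ~ `|psum x b n - psum x b N| <= e >].
have exP : exists n, P n by exists n; apply/asboolP.
case: (ex_minnP exP) => m /asboolP[Nm bm] minm.
exists m => //; split => // i /andP[Ni im].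
by apply: contrapT => bi; move: im; rewrite ltnNge minm//; apply/asboolP.
Qed.

Lemma determined_first_exit N e n : determined n (first_exit N e n).
Proof.
move=> b b' bb' [Nn bn bm]; split => //.
  rewrite -(@eq_psum _ _ x b b' n)// -(@eq_psum _ _ x b b' N)// => i iN.
  by apply: bb'; exact: leq_trans Nn.
move=> m /[dup] /bm + /andP[Nm mn].
rewrite (@eq_psum _ _ x b b' m) ?(@eq_psum _ _ x b b' N)// => i iN; apply: bb'.
  exact: leq_trans Nn.
exact: ltn_trans mn.
Qed.

Lemma measurable_first_exit N e n : measurable (first_exit N e n).
Proof. exact: (determined_measurable (determined_first_exit (n := n))). Qed.

Lemma measurable_oscillates N e : measurable (oscillates N e).
Proof.
rewrite oscillatesE; apply: bigcupT_measurable => n.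
exact: measurable_first_exit.
Qed.

Lemma trivIset_first_exit N e : trivIset setT (first_exit N e).
Proof.
apply/trivIsetP => m n _ _ mn.
apply/seteqP; split => // b [[Nm bm mP] [Nn bn nP]].
case: (ltngtP m n) mn => // [mn|nm] _.
  by apply: bm; apply: nP; rewrite Nm.
by apply: bn; apply: mP; rewrite Nn.
Qed.

(** The first exit at time n depends on the signs before n only. *)
Lemma flip_first_exit N e n :
  flip (from n) @^-1` first_exit N e n = first_exit N e n.
Proof.
apply/seteqP; split=> b; apply: determined_first_exit => i im;
  by rewrite /flip /from leqNgt im addbF.
Qed.

Context {R : realType} (mu : probability sign_seq R) (mu_fair : fair mu).
Variable (A : set sign_seq).
Hypothesis fullA : full mu A.

(** The reflection principle. On the first exit at time n, the sequence or its
    reflection at n lies in M. Both alternatives have the same probability, as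
    the reflection preserves the law and the first exit event; so M carries at
    least half of each first exit event, and these events are disjoint. *)
Lemma levy_inequality N e (M : set sign_seq) : measurable M ->
  (forall n b, A b -> first_exit N e n b -> M b \/ M (flip (from n) b)) ->
  (mu (oscillates N e) <= 2%:E * mu M)%E.
Proof.
move=> mM HM.
have mF := measurable_first_exit N e.
have mFM n : measurable (first_exit N e n `&` M) by exact: measurableI.
have tF : trivIset setT (first_exit N e) by exact: trivIset_first_exit.
have half n : (mu (first_exit N e n) <= 2%:E * mu (first_exit N e n `&` M))%E.
  set F := first_exit N e n `&` M.
  have mflip : measurable (flip (from n) @^-1` F).
    rewrite -[X in measurable X]setTI; apply: measurable_flip => //.
    exact: mFM.
  apply: (@le_trans _ _ (mu (F `|` flip (from n) @^-1` F))).
    apply: (full_le fullA) => //; first by apply: measurableU => //; exact: mFM.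
    move=> b Ab Fb; case: (HM n b Ab Fb) => Mb; [left|right] => //.
    by rewrite preimage_setI flip_first_exit.
  have U2 : (mu (F `|` flip (from n) @^-1` F) <=
      mu F + mu (flip (from n) @^-1` F))%E.
    by apply: measureU2 => //; exact: mFM.
  apply: (le_trans U2).
  by rewrite fair_flip ?(mule_natl _ 2) ?mule2n//; exact: mFM.
rewrite oscillatesE measure_bigcup//.
apply: (@le_trans _ _ (\sum_(0 <= n <oo) 2%:E * mu (first_exit N e n `&` M))%E).
  rewrite (eq_eseriesl (Q := xpredT)); last by move=> i; rewrite in_setT.
  by apply: lee_nneseries => // n _; exact: half.
rewrite nneseriesZl//; apply: lee_wpmul2l => //.
rewrite (_ : \sum_(0 <= n <oo) _ =
    mu (\bigcup_n (first_exit N e n `&` M)))%E; last first.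
  rewrite measure_bigcup//.
    by apply: eq_eseriesl => i; rewrite in_setT.
  exact: trivIset_setIr.
apply: le_measure; rewrite ?inE//; first exact: bigcupT_measurable.
by move=> b [n _ []].
Qed.

End levy.

(** * The Ito-Nisio argument for a topology with tau-closed balls *)

Section ito_nisio.
Context (K : numFieldType) (X : normedModType K) (tau : topology_on X).
Hypothesis archK : forall e : K, 0 < e -> exists n, n.+1%:R^-1 < e.
Local Notation Xtau := (retopologize tau).
Hypothesis tvs_tau : locally_convex_tvs Xtau.
Hypothesis tau_weaker : forall A : set X, open (A : set Xtau) -> open A.
Hypothesis tau_ball : closed ([set x : X | `|x| <= 1] : set Xtau).

Variable (x : nat -> X).

Definition sums_to (b : sign_seq) (s : X) :=
  (psum x b : nat -> Xtau) @ \oo --> (s : Xtau).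

Lemma sums_to_tail b s c : sums_to b s ->
  (fun n => psum x b n - c : Xtau) @ \oo --> (s - c : Xtau).
Proof. exact: tvs_cvgB_cst. Qed.

Lemma sums_to_flip m b s : sums_to b s ->
  sums_to (flip (from m) b) (psum x b m - (s - psum x b m)).
Proof.
move=> /(sums_to_tail (c := psum x b m)).
move=> /(tvs_cvg_cstB tvs_tau (c := psum x b m)).
apply: cvg_trans; apply: near_eq_cvg; near=> n.
by rewrite psum_flip_after//; near: n; exists m.
Unshelve. all: by end_near. Qed.

Variable D : nat -> X.
Hypothesis hull : forall b N (s : X),
  (fun n => psum x b n - psum x b N : Xtau) @ \oo --> (s : Xtau) ->
  closure (range D) s.

(** Measurability of the events about the tau-sum that the proof needs. By
    tau_exhaustion the tail s - S_N is outside the ball if and only if the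
    differences S_n - S_N are eventually in one of countably many sets; each
    such condition on n concerns finitely many signs. *)
Lemma outside_event N (z : X) (r : K) : 0 < r ->
  exists W : set sign_seq, measurable W /\
  forall b s, sums_to b s -> (W b <-> ~ `|s - psum x b N - z| <= r).
Proof.
move=> r0; have oW : open (~` [set y : X | `|y - z| <= r] : set Xtau).
  by apply: closed_openC; exact: tau_closed_ball.
have [U [oU UW UD]] := tau_exhaustion archK tvs_tau tau_weaker D oW.
exists (\bigcup_i \bigcup_j \bigcup_m \bigcap_(n >= m)
   [set b : sign_seq | U (i, j) (psum x b n - psum x b N)]); split.
  apply: bigcupT_measurable => i; apply: bigcupT_measurable => j.
  apply: bigcupT_measurable => m; apply: bigcap_measurable.
    by exists m => /=.
  move=> n _; apply: (determined_measurable (n := maxn n N)).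
  exact: determined_psum.
move=> b s bs; have bsN := sums_to_tail (c := psum x b N) bs; split.
  move=> [i _ [j _ [m _ H]]]; apply: (UW (i, j)) => V nV.
  have [n0 _ Vn] := bsN _ nV.
  exists (psum x b (maxn n0 m) - psum x b N); split.
    by apply: H; rewrite /= leq_maxr.
  by apply: Vn; rewrite /= leq_maxl.
move=> /UD/(_ (hull bsN))[[i j] Us].
have [m _ H] := bsN _ (open_nbhs_nbhs (conj (oU (i, j)) Us)).
by exists i => //; exists j => //; exists m => // n /= /H.
Qed.

(** The complement of the ball about z is a tau-neighbourhood of 0, the
    tau-limit of s - S_n. *)
Lemma remainder_avoids b s (z : X) (r : K) :
  0 < r -> ~ `|z| <= r -> sums_to b s ->
  \forall n \near \oo, ~ `|s - psum x b n - z| <= r.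
Proof.
move=> r0 zr /(tvs_cvg_remainder tvs_tau)/(_ (~` [set y : X | `|y - z| <= r])).
apply.
apply: open_nbhs_nbhs; split.
  by apply: closed_openC; exact: tau_closed_ball.
by rewrite /= sub0r normrN.
Qed.

Context {R : realType} (mu : probability sign_seq R) (mu_fair : fair mu).
Hypothesis full_sums : full mu [set b | exists s, sums_to b s].

(** Symmetrisation. With r = e / 3, the event M collects what may go wrong: s
    is far from the first k points of D, or so is its reflection 2 S_N - s, or
    s - S_N is close to one of the points z = (D i - D j) / 2 with |z| > 2 r.
    Off M the tail s - S_N, which is half of s - (2 S_N - s), is within r of a
    point z with |z| <= 2 r. *)
Lemma tail_small (e : K) (delta : R) : 0 < e -> 0 < delta ->
  exists N M, [/\ measurable M, (mu M <= delta%:E)%E &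
    forall b s, sums_to b s -> ~ M b -> `|s - psum x b N| <= e].
Proof.
move=> e0 d0; pose r := e / 3%:R; pose d := delta / 3%:R.
have r0 : 0 < r by rewrite divr_gt0.
have dd0 : 0 < d by rewrite divr_gt0.
have /choice[W HW] : forall p : nat * X,
  exists W : set sign_seq, measurable W /\
  forall b s, sums_to b s -> (W b <-> ~ `|s - psum x b p.1 - p.2| <= r).
  by move=> [N z]; exact: outside_event.
have mW p : measurable (W p) by case: (HW p).
have {}HW p b s (bs : sums_to b s) : W p b <-> ~ `|s - psum x b p.1 - p.2| <= r.
  by case: (HW p) => _; exact.
(* B k: the sum is outside the balls around the first k points of D. *)
pose B k := \bigcap_(i < k) W (0%N, D i).
have mB k : measurable (B k) by exact: fin_bigcap_measurable.
have B0 k b s : sums_to b s -> ~ B k b ->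
    exists2 i, (i < k)%N & `|s - D i| <= r.
  move=> bs; apply: contra_notP => nr i /= ik; apply/(HW _ _ _ bs) => /=.
  rewrite /psum big_geq// subr0 => sr; apply: nr; exists i => //.
have [k muB] : exists k, (mu (B k) <= d%:E)%E.
  apply: (full_cvg0 full_sums) => //.
    by move=> m n mn b Bn i im; apply: Bn; exact: leq_trans im mn.
  move=> b [s bs].
  have /(_ _ (nbhsx_ballx s _ r0)) : closure (range D) s.
    apply: (@hull b 0%N).
    rewrite (_ : (fun n => _) = (psum x b : nat -> Xtau))//.
    by apply/funext => n; rewrite [X in _ - X]/psum [X in _ - X]big_geq// subr0.
  move=> [_ [[i _ <-]]]; rewrite -ball_normE /= => /ltW si.
  exists i.+1 => /(_ i (ltnSn i)) /(HW _ _ _ bs) /=.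
  by rewrite /psum big_geq// subr0.
(* z ranges over the finite set of possible approximate values of a tail; V n
   is the event that the tail s - S_n is near one of those of norm > 2 r. *)
pose z (p : 'I_k * 'I_k) := 2^-1 *: (D p.1 - D p.2).
pose V n := \bigcup_(p in [set p | ~ `|z p| <= 2 * r]) ~` W (n, z p).
have mV n : measurable (V n).
  by apply: fin_bigcup_measurable => // p _; exact: measurableC.
have Vlim b s : sums_to b s -> \forall n \near \oo, ~ V n b.
  move=> bs; have : \forall n \near \oo, forall p,
      ~ `|z p| <= 2 * r -> W (n, z p) b.
    apply: filter_forall => p; have [zp|zp] := pselect (`|z p| <= 2 * r).
      by near=> n.
    have zr : ~ `|z p| <= r.
      by move=> zr; apply: zp; rewrite (le_trans zr)// ler_peMl ?ler1n// ltW.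
    have := remainder_avoids r0 zr bs; apply: filterS => n h _.
    exact/(HW _ _ _ bs).
  by apply: filterS => n h [p zp]; apply; exact: h.
have [N muG] : exists N, (mu (\bigcup_(n >= N) V n) <= d%:E)%E.
  apply: (full_cvg0 full_sums) => //.
  - by move=> n; apply: bigcup_measurable.
  - by move=> m n mn b [j /= nj Vj]; exists j => //=; exact: leq_trans nj.
  - move=> b [s /Vlim[n _ nV]]; exists n => -[j /= nj]; exact: nV.
have mfB : measurable (flip (from N) @^-1` B k).
  by rewrite -[X in measurable X]setTI; exact: measurable_flip.
exists N, (B k `|` flip (from N) @^-1` B k `|` V N); split.
- by apply: measurableU => //; exact: measurableU.
- have U2 A A' : measurable A -> measurable A' ->
    (mu (A `|` A') <= mu A + mu A')%E by move=> mA mA'; exact: measureU2.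
  have -> : delta = d + d + d by rewrite /d; field.
  rewrite !EFinD; apply: le_trans (U2 _ _ _ _) _ => //.
    exact: measurableU.
  apply: leeD; last first.
    apply: le_trans muG; apply: le_measure; rewrite ?inE//.
      exact: bigcup_measurable.
    by move=> b Vb; exists N => /=.
  by apply: le_trans (U2 _ _ _ _) _ => //; apply: leeD; rewrite ?fair_flip.
move=> b s bs /not_orP[/not_orP[nB nfB] nV].
have [i ik si] := B0 _ _ _ bs nB.
have [j jk sj] := B0 _ _ _ (sums_to_flip (m := N) bs) nfB.
pose p := (Ordinal ik, Ordinal jk).
have szp : `|s - psum x b N - z p| <= r.
  rewrite (_ : _ - z p =
    2^-1 *: ((s - D i) - (psum x b N - (s - psum x b N) - D j))).
    rewrite normrZ ger0_norm ?invr_ge0// ler_pdivrMl// mulr_natl mulr2n.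
    by rewrite (le_trans (ler_normB _ _))// lerD.
  have {1}-> : s - psum x b N = 2^-1 *: (2 *: (s - psum x b N)).
    by rewrite scalerA mulVf// scale1r.
  rewrite -scalerBr; congr (_ *: _); rewrite scaler_nat mulr2n /z /=.
  set t := s - _; rewrite !opprB [RHS]addrA [in RHS]addrA.
  by rewrite -/t [RHS](ACl (1*5*4*3*2)) /= -/t !addrA.
have zr : `|z p| <= 2 * r.
  apply: contrapT => zr; apply: nV; exists p => // Wp.
  by case: (HW (N, z p) b s bs) => /(_ Wp).
rewrite -(subrK (z p) (s - psum x b N)) (le_trans (ler_normD _ _))//.
have -> : e = r + 2 * r by rewrite /r; field.
exact: lerD.
Unshelve. all: by end_near.
Qed.

(** The failure of the Cauchy criterion. The levels 1 / (j + 1) keep the union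
    countable, and suffice over archimedean scalars. *)
Definition diverges : set sign_seq :=
  \bigcup_j \bigcap_N oscillates x N (j.+1%:R^-1).

(** At the first exit time n, the tails s - S_N and s' - S_N of the sequence
    and of its reflection at n add up to 2 (S_n - S_N), so they cannot both be
    bounded by e. *)
Lemma levy_tail N (e : K) M : measurable M ->
  (forall b s, sums_to b s -> ~ M b -> `|s - psum x b N| <= e) ->
  (mu (oscillates x N e) <= 2%:E * mu M)%E.
Proof.
move=> mM HM.
apply: (levy_inequality mu_fair full_sums) => // n b [s bs] [Nn bn _].
apply: contra_notP bn => /not_orP[nM nfM].
have h1 := HM _ _ bs nM; have := HM _ _ (sums_to_flip (m := n) bs) nfM.
rewrite psum_flip_before// => h2.
have -> : psum x b n - psum x b N = 2^-1 *:
    ((s - psum x b N) + ((psum x b n - (s - psum x b n)) - psum x b N)).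
  rewrite -[LHS]scale1r -[X in X *: _](@mulVf _ 2)// -scalerA; congr (_ *: _).
  rewrite scaler_nat mulr2n opprB !addrA.
  by rewrite [RHS](ACl (1*5*3*2*4*6)) /= subrr add0r.
rewrite normrZ ger0_norm ?invr_ge0// ler_pdivrMl// mulr_natl mulr2n.
by rewrite (le_trans (ler_normD _ _))// lerD.
Qed.

Lemma measurable_diverges : measurable diverges.
Proof.
apply: bigcupT_measurable => j; apply: bigcapT_measurable => N.
exact: measurable_oscillates.
Qed.

Theorem null_diverges : mu diverges = 0%E.
Proof.
have mosc j N : measurable (oscillates x N (j.+1%:R^-1)).
  exact: measurable_oscillates.
apply/negligibleP; first exact: measurable_diverges.
apply: negligible_bigcup => j.
apply/negligibleP; first exact: bigcapT_measurable.
apply/eqP; rewrite eq_le measure_ge0 andbT; apply/lee_addgt0Pr => delta delta0.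
rewrite add0e.
have j0 : (0 : K) < j.+1%:R^-1 by rewrite invr_gt0.
have half0 : 0 < delta / 2 by rewrite divr_gt0.
have [N [M [mM muM HM]]] := tail_small j0 half0.
apply: (@le_trans _ _ (mu (oscillates x N (j.+1%:R^-1)))).
  apply: le_measure; rewrite ?inE//; first exact: bigcapT_measurable.
  by move=> b; exact.
apply: (le_trans (levy_tail mM HM)).
rewrite (_ : delta%:E = 2%:E * (delta / 2)%:E)%E; last first.
  by rewrite -EFinM mulrC divfK.
by apply: lee_wpmul2l.
Qed.

End ito_nisio.

(** * The Hahn-Banach theorem *)

Section hahn_banach.
Context (R : realType) (V : lmodType R).
Implicit Types (p q : V -> R) (x y z : V).

(** Homogeneity is required as an inequality only; the equality
    follows, see sublinearZ. *)
Definition sublinear p := (forall x y, p (x + y) <= p x + p y) /\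
  (forall r x, 0 < r -> p (r *: x) <= r * p x).

Lemma sublinearZ p r x : sublinear p -> 0 < r -> p (r *: x) = r * p x.
Proof.
move=> [_ ph] r0; apply/eqP; rewrite eq_le ph//= -ler_pdivlMl//.
have := ph r^-1 (r *: x); rewrite scalerA mulVf ?gt_eqF// scale1r; apply.
by rewrite invr_gt0.
Qed.

Lemma sublinear0 p : sublinear p -> p 0 = 0.
Proof.
by move=> sp; have := sublinearZ 0 sp (ltr0n R 2); rewrite scaler0; lra.
Qed.

Lemma sublinearN p x : sublinear p -> - p (- x) <= p x.
Proof.
move=> sp; have := sp.1 x (- x); rewrite subrr sublinear0//; lra.
Qed.

(** The largest sublinear function below p whose value at -y is at most
    - p y; linear functions below it must take the value p y at y. *)
Definition sharpen p y x : R :=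
  inf [set p (x + t *: y) - t * p y | t in [set t | 0 <= t]].

Lemma sharpen_lb p x y t : sublinear p -> 0 <= t ->
  - p (- x) <= p (x + t *: y) - t * p y.
Proof.
move=> sp; rewrite le_eqVlt => /predU1P[<-|t0].
  by rewrite scale0r addr0 mul0r subr0; exact: sublinearN.
have := sp.1 (x + t *: y) (- x).
by rewrite addrC addKr sublinearZ//; lra.
Qed.

Lemma sharpen_le p x y t : sublinear p -> 0 <= t ->
  sharpen p y x <= p (x + t *: y) - t * p y.
Proof.
move=> sp t0; apply: ge_inf; last by exists t.
by exists (- p (- x)) => _ [u u0 <-]; exact: sharpen_lb.
Qed.

Lemma le_sharpen p x y c :
  (forall t, 0 <= t -> c <= p (x + t *: y) - t * p y) -> c <= sharpen p y x.
Proof.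
move=> H; apply: lb_le_inf.
  by exists (p (x + 0 *: y) - 0 * p y), 0 => //=.
by move=> _ [t t0 <-]; exact: H.
Qed.

Lemma sharpen_sublinear p y : sublinear p -> sublinear (sharpen p y).
Proof.
move=> sp; split=> [x z|r x r0].
  rewrite -lerBlDr; apply: le_sharpen => t t0.
  rewrite lerBlDr -lerBlDl; apply: le_sharpen => u u0.
  rewrite lerBlDl; apply: le_trans (sharpen_le _ _ sp (addr_ge0 t0 u0)) _.
  have := sp.1 (x + t *: y) (z + u *: y).
  by rewrite addrACA -scalerDl; lra.
rewrite mulrC -ler_pdivrMr//; apply: le_sharpen => t t0.
rewrite ler_pdivrMr//.
apply: le_trans (sharpen_le _ _ sp (mulr_ge0 (ltW r0) t0)) _.
by rewrite -scalerA -scalerDr sublinearZ//; lra.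
Qed.

Lemma sharpen_le_id p y x : sublinear p -> sharpen p y x <= p x.
Proof.
move=> sp; apply: le_trans (sharpen_le _ _ sp (lexx 0)) _.
by rewrite scale0r addr0 mul0r subr0.
Qed.

Lemma sharpenN p y : sublinear p -> sharpen p y (- y) <= - p y.
Proof.
move=> sp; apply: le_trans (sharpen_le _ _ sp ler01) _.
by rewrite scale1r addNr sublinear0// mul1r sub0r.
Qed.

(** Zorn's lemma: a chain of sublinear functions below p is bounded below at x
    by -p(-x), and its pointwise infimum is sublinear. *)
Lemma minimal_sublinear p : sublinear p ->
  exists q, [/\ sublinear q, forall x, q x <= p x &
    forall q', sublinear q' -> (forall x, q' x <= q x) ->
      forall x, q x <= q' x].
Proof.
move=> sp; pose T := {q | sublinear q /\ forall x, q x <= p x}.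
pose below (q q' : T) := `[< forall x, sval q' x <= sval q x >].
pose top : T := exist _ p (conj sp (fun=> lexx _)).
have [||A totA|[q [sq qp]] qmax] := @ZL_preorder T top below.
- by move=> q; apply/asboolP.
- move=> q1 q2 q3 /asboolP h1 /asboolP h2; apply/asboolP => x.
  exact: le_trans (h1 x).
- have [[q0 Aq0]|A0] := pselect (A !=set0); last first.
    by exists top => q Aq; exfalso; apply: A0; exists q.
  pose m x := inf [set sval q x | q in A].
  have hlb x : has_lbound [set sval q x | q in A].
    exists (- p (- x)) => _ [[q [sq qp]] _ <-] /=.
    by apply: le_trans (sublinearN x sq); rewrite lerN2.
  have mle (q : T) x : A q -> m x <= sval q x.
    by move=> Aq; apply: ge_inf => //; exists q.
  have lem c x : (forall q : T, A q -> c <= sval q x) -> c <= m x.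
    move=> H; apply: lb_le_inf; first by exists (sval q0 x), q0.
    by move=> _ [q Aq <-]; exact: H.
  have sm : sublinear m.
    split=> [x y|r x r0].
      rewrite -lerBlDr; apply: (lem _ x) => q Aq.
      rewrite lerBlDr -lerBlDl; apply: (lem _ y) => q' Aq'.
      (* the smaller of q and q' serves both for x and for y *)
      rewrite lerBlDl; have [/asboolP h|/asboolP h] := totA _ _ Aq Aq'.
        apply: le_trans (mle _ _ Aq') _; apply: le_trans ((svalP q').1.1 x y) _.
        by rewrite lerD2r.
      apply: le_trans (mle _ _ Aq) _; apply: le_trans ((svalP q).1.1 x y) _.
      by rewrite lerD2l.
    rewrite mulrC -ler_pdivrMr//; apply: (lem _ x) => q Aq.
    rewrite ler_pdivrMr//.
    by apply: le_trans (mle _ _ Aq) _; rewrite mulrC; exact: (svalP q).1.2.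
  have mp x : m x <= p x.
    by apply: le_trans (mle _ x Aq0) _; exact: (svalP q0).2.
  by exists (exist _ m (conj sm mp)) => q Aq; apply/asboolP => x; exact: mle.
exists q; split => // q' sq' q'q.
have q'p x : q' x <= p x by apply: le_trans (qp x).
have := qmax (exist _ q' (conj sq' q'p)).
by move=> /(_ (introT (asboolP _) q'q))/asboolP.
Qed.

(** Minimal sublinear functions are linear. Indeed, if q is minimal then
    sharpen q z cannot be smaller than q, so that q(-z) <= -q(z) for every z,
    and a sublinear odd function is linear. Minimising below sharpen p y instead
    of p forces the value p y at y. *)
Lemma hahn_banach p y : sublinear p ->
  exists f : {scalar V}, (forall x, f x <= p x) /\ f y = p y.
Proof.
move=> sp; have [q [sq qp qmin]] := minimal_sublinear (sharpen_sublinear y sp).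
have qN z : q (- z) = - q z.
  have := sublinearN (- z) sq; rewrite opprK => h.
  apply/eqP; rewrite eq_le h andbT.
  apply: le_trans (sharpenN z sq).
  by apply: qmin; [exact: sharpen_sublinear|move=> x; exact: sharpen_le_id].
have qD x z : q (x + z) = q x + q z.
  apply/eqP; rewrite eq_le sq.1/= -lerN2 -qN !opprD -!qN; exact: sq.1.
have qZ r x : q (r *: x) = r * q x.
  have [r0|r0|->] := ltgtP r 0; last by rewrite scale0r mul0r sublinear0.
    by rewrite -[r]opprK scaleNr qN mulNr sublinearZ// oppr_gt0.
  exact: sublinearZ.
have ql : scalar q by move=> r x z; rewrite qD qZ.
pose f : {scalar V} := HB.pack q (GRing.isLinear.Build R V R *%R q ql).
exists f; split => [x|] /=.
  exact: le_trans (qp x) (sharpen_le_id _ _ sp).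
apply/eqP; rewrite eq_le (le_trans (qp y) (sharpen_le_id _ _ sp))/=.
by rewrite -lerN2 -qN (le_trans (qp _))// sharpenN.
Qed.

End hahn_banach.

(** * Real scalars and real functionals *)

Section real_scalars.
Context (R : realType) (k : scalar_kind).
Local Notation rs := (@real_scalar R k).

Lemma real_scalarD a b : rs (a + b) = rs a + rs b.
Proof. by case: k => //=; exact: rmorphD. Qed.

Lemma real_scalarM a b : rs (a * b) = rs a * rs b.
Proof. by case: k => //=; exact: rmorphM. Qed.

Lemma real_scalar1 : rs 1 = 1.
Proof. by case: k. Qed.

Lemma real_scalar_le a b : (rs a <= rs b) = (a <= b).
Proof. by case: k => //=; exact: lecR. Qed.

Lemma real_scalar_lt a b : (rs a < rs b) = (a < b).
Proof. by case: k => //=; exact: ltcR. Qed.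

Lemma real_scalar0 : rs 0 = 0.
Proof. by case: k. Qed.

Lemma real_scalarN a : rs (- a) = - rs a.
Proof. by case: k => //=; exact: rmorphN. Qed.

Lemma real_scalar_norm a : `|rs a| = rs `|a|.
Proof.
case: k; first by [].
have := normc_def (a%:C)%C; rewrite /= expr0n addr0 sqrtr_sqr; exact.
Qed.

Lemma real_scalar_surj (z : scalars R k) : 0 <= z -> exists a, z = rs a.
Proof.
case: k z => /= z; first by exists z.
by move=> /ger0_norm <-; rewrite normc_def; eexists.
Qed.

Lemma real_scalar_nat n : rs n%:R = n%:R.
Proof.
elim: n => [|n IH]; first exact: real_scalar0.
by rewrite -addn1 !natrD real_scalarD IH real_scalar1.
Qed.

Lemma scalars_archi (e : scalars R k) : 0 < e -> exists n, n.+1%:R^-1 < e.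
Proof.
move=> e0; have [a ea] := real_scalar_surj (ltW e0).
have a0 : 0 < a by rewrite -real_scalar_lt real_scalar0 -ea.
have [n _ /(_ n (leqnn n)) na] := near_infty_natSinv_lt (PosNum a0).
exists n; rewrite -[ltLHS]mul1r ltr_pdivrMr ?ltr0n// ea.
rewrite -real_scalar_nat -real_scalarM.
by rewrite -real_scalar1 real_scalar_lt -ltr_pdivrMr ?ltr0n// mul1r.
Qed.

End real_scalars.

(** Restriction of scalars to the reals, so that the real Hahn-Banach theorem
    applies to complex spaces too. *)
Definition real_module (R : realType) (k : scalar_kind)
  (X : lmodType (scalars R k)) : Type := X.

Section real_module.
Context (R : realType) (k : scalar_kind) (X : lmodType (scalars R k)).
Local Notation rs := (@real_scalar R k).

HB.instance Definition _ := GRing.Zmodule.on (real_module X).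

Let real_scale (r : R) (v : real_module X) : real_module X := rs r *: (v : X).

Let real_scaleA a b v : real_scale a (real_scale b v) = real_scale (a * b) v.
Proof. by rewrite /real_scale scalerA real_scalarM. Qed.

Let real_scale1 : left_id 1 real_scale.
Proof. by move=> v; rewrite /real_scale real_scalar1 scale1r. Qed.

Let real_scaleDr : right_distributive real_scale +%R.
Proof. by move=> a u v; exact: scalerDr. Qed.

Let real_scaleDl v : {morph real_scale^~ v : a b / a + b}.
Proof. by move=> a b; rewrite /real_scale real_scalarD scalerDl. Qed.

HB.instance Definition _ := GRing.Zmodule_isLmodule.Build R (real_module X)
  real_scaleA real_scale1 real_scaleDr real_scaleDl.

Lemma real_moduleZ (r : R) (v : X) : r *: (v : real_module X) = rs r *: v.
Proof. by []. Qed.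

End real_module.

Section weak.
Context (R : realType) (k : scalar_kind) (X : normedModType (scalars R k)).
Local Notation rs := (@real_scalar R k).

(** The norm takes values in the scalar field; this is the real number
    behind it. *)
Definition rnorm (v : X) : R := sval (cid (real_scalar_surj (normr_ge0 v))).

Lemma rnormE v : rs (rnorm v) = `|v|.
Proof. by rewrite /rnorm; case: cid. Qed.

Lemma rnorm_ge0 v : 0 <= rnorm v.
Proof. by rewrite -(@real_scalar_le R k) rnormE real_scalar0. Qed.

Lemma rnormD u v : rnorm (u + v) <= rnorm u + rnorm v.
Proof. by rewrite -(@real_scalar_le R k) real_scalarD !rnormE ler_normD. Qed.

Lemma rnormZ r v : rnorm (rs r *: v) = `|r| * rnorm v.
Proof.
apply/eqP; rewrite eq_le -!(@real_scalar_le R k) -eq_le real_scalarM !rnormE.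
by rewrite normrZ real_scalar_norm.
Qed.

Lemma rnormN v : rnorm (- v) = rnorm v.
Proof.
by rewrite -scaleN1r -(real_scalar1 R k) -real_scalarN rnormZ normrN1 mul1r.
Qed.

End weak.

Lemma bounded_functional_continuous (K : numFieldType) (X : normedModType K)
    (g : {linear X -> K^o}) (c : K) :
  0 < c -> (forall v, `|g v| <= c * `|v|) -> continuous g.
Proof.
move=> c0 gc y; apply/cvgrPdist_lt => e e0; near=> z.
rewrite -linearB (le_lt_trans (gc _))// mulrC -ltr_pdivlMr//.
near: z; apply: (@cvgr_dist_lt _ _ _ _ _ _ _ cvg_id); exact: divr_gt0.
Unshelve. all: by end_near. Qed.

(** Over the complex numbers a real functional f is the real part of the
    complex functional f(v) - i f(iv). *)
Lemma real_functional_dual (R : realType) (k : scalar_kind)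
  (X : normedModType (scalars R k)) (f : {scalar (real_module X)}) :
  (forall v : X, `|f v| <= rnorm v) ->
  exists g : dual X, forall v, real_scalar k `|f v| <= `|sval g v|.
Proof.
case: k X f => X f fle.
  have fl : scalar (f : X -> R) by move=> a u v; exact: linearP.
  pose g : {linear X -> R^o} := HB.pack (f : X -> R^o)
    (GRing.isLinear.Build R X R^o *:%R (f : X -> R^o) fl).
  have gc : continuous g.
    apply: (@bounded_functional_continuous _ _ g 1) => // v; rewrite mul1r.
    by rewrite -(rnormE v); exact: fle.
  by exists (exist _ g gc) => v /=.
pose h (v : X) : R[i]^o := (f v +i* - f ('i *: v))%C.
have fD u v : f ((u : X) + v) = f u + f v by exact: linearD.
have fZ (r : R) (v : X) : f (r%:C%C *: v) = r * f v by exact: (scalarZ f r v).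
have hl : linear h.
  move=> [a b] u v; rewrite /h.
  have ab w : (a +i* b)%C *: w = a%:C%C *: w + b%:C%C *: ('i%C *: w) :> X.
    by rewrite scalerA -scalerDl; congr (_ *: _); simpc.
  have iab w : 'i%C *: ((a +i* b)%C *: w) =
      a%:C%C *: ('i%C *: w) - b%:C%C *: w :> X.
    rewrite ab scalerDr !scalerA -scalerBl -scalerDl; congr (_ *: _); by simpc.
  rewrite scalerDr iab ab !fD.
  have fN w : f (- (w : X)) = - f w by exact: linearN.
  rewrite fN !fZ /GRing.scale /=; simpc; congr (_ +i* _)%C; ring.
pose g : {linear X -> R[i]^o} :=
  HB.pack h (GRing.isLinear.Build R[i] X R[i]^o *:%R h hl).
have gc : continuous g.
  (* both coordinates of h v are bounded by the norm of v *)
  apply: (@bounded_functional_continuous _ _ g 2) => // v.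
  have iv : rnorm ('i%C *: v) = rnorm v.
    apply/eqP; rewrite eq_le -!(@real_scalar_le R ComplexScalars) -eq_le.
    by rewrite !rnormE normrZ normc_def /= expr0n expr1n add0r sqrtr1 mul1r.
  have fv := fle v; have fiv := fle ('i%C *: v); rewrite iv in fiv.
  have n0 := rnorm_ge0 v.
  suff : `|h v| <= real_scalar ComplexScalars (2 * rnorm v).
    by rewrite real_scalarM rnormE real_scalar_nat.
  rewrite normc_def /= lecR.
  rewrite -[leRHS]ger0_norm ?mulr_ge0// -sqrtr_sqr ler_wsqrtr// sqrrN.
  rewrite -(real_normK (num_real (f v))).
  rewrite -(real_normK (num_real (f ('i%C *: v)))).
  have a0 := normr_ge0 (f v); have b0 := normr_ge0 (f ('i%C *: v)).
  nra.
exists (exist _ g gc) => v /=.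
by rewrite normc_def /= lecR -sqrtr_sqr ler_wsqrtr// lerDl sqr_ge0.
Qed.

(** * Weak limits stay in the closed real span *)

Section real_span.
Context (R : realType) (k : scalar_kind) (X : normedModType (scalars R k)).
Variable x : nat -> X.
Local Notation rs := (@real_scalar R k).

Definition combination (l : seq (R * nat)) : X := \sum_(p <- l) rs p.1 *: x p.2.

Definition rational_combination (n : nat) : X :=
  combination (if choice.unpickle n is Some l
    then [seq (ratr p.1, p.2) | p : rat * nat <- l] else [::]).

Lemma combinationD l l' :
  combination l + combination l' = combination (l ++ l').
Proof. by rewrite /combination big_cat. Qed.

Lemma combinationZ r l :
  rs r *: combination l = combination [seq (r * p.1, p.2) | p <- l].
Proof.
rewrite /combination big_map scaler_sumr; apply: eq_bigr => p _.
by rewrite scalerA real_scalarM.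
Qed.

Lemma rational_approximation l (e : R) : 0 < e ->
  exists n, rnorm (combination l - rational_combination n) < e.
Proof.
move=> e0.
suff [l' le] : exists l' : seq (rat * nat),
    rnorm (combination l - combination [seq (ratr p.1, p.2) | p <- l']) < e.
  by exists (choice.pickle l'); rewrite /rational_combination choice.pickleK.
elim: l e e0 => [|[r i] l IH] e e0.
  exists [::]; rewrite subrr -(scale0r 0) -(real_scalar0 R k) rnormZ.
  by rewrite normr0 mul0r.
have e20 : 0 < e / 2 by rewrite divr_gt0.
have [l' Hl'] := IH (e / 2) e20.
(* x i may be 0, so 1 is added to its norm before dividing *)
have d0 : 0 < e / 2 / (rnorm (x i) + 1).
  by rewrite !divr_gt0// ltr_wpDl// rnorm_ge0.
have [q /[!in_itv]/= /andP[rq qr]] := rat_in_itvoo (ltr_pwDr d0 (lexx r)).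
exists ((q, i) :: l').
rewrite /combination /= !big_cons /= opprD addrACA -scalerBl.
rewrite -real_scalarN -real_scalarD (splitr e).
rewrite (le_lt_trans (rnormD _ _))// ltr_leD ?ltW//.
rewrite rnormZ distrC gtr0_norm ?subr_gt0//.
have : ratr q - r < e / 2 / (rnorm (x i) + 1) by rewrite ltrBlDl.
have n0 := rnorm_ge0 (x i).
rewrite ltr_pdivlMr ?ltr_wpDl//; have : 0 < ratr q - r by rewrite subr_gt0.
nra.
Qed.

(** The distance to the real span of the x_n, taken as the sublinear function
    in the Hahn-Banach theorem: a functional below it vanishes on the span. *)
Definition span_dist (v : X) : R :=
  inf [set rnorm (v - combination l) | l in setT].

Lemma span_dist_le v l : span_dist v <= rnorm (v - combination l).
Proof.
by apply: ge_inf; [exists 0 => _ [l' _ <-]; exact: rnorm_ge0|exists l].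
Qed.

Lemma le_span_dist v c :
  (forall l, c <= rnorm (v - combination l)) -> c <= span_dist v.
Proof.
move=> H; apply: lb_le_inf.
  by exists (rnorm (v - combination [::])), [::].
by move=> _ [l _ <-]; exact: H.
Qed.

Lemma span_dist_sublinear : sublinear (span_dist : real_module X -> R).
Proof.
split=> [u v|r v r0].
  rewrite -lerBlDr; apply: le_span_dist => l.
  rewrite lerBlDr -lerBlDl; apply: le_span_dist => l'; rewrite lerBlDl.
  apply: le_trans (span_dist_le _ (l ++ l')) _.
  by rewrite -combinationD opprD addrACA rnormD.
rewrite mulrC -ler_pdivrMr//; apply: le_span_dist => l; rewrite ler_pdivrMr//.
apply: le_trans (span_dist_le _ [seq (r * p.1, p.2) | p <- l]) _.
by rewrite -combinationZ real_moduleZ -scalerBr rnormZ gtr0_norm// mulrC.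
Qed.

Lemma dual_weak_continuous (g : dual X) :
  continuous (sval g : weak_topology X -> (scalars R k)^o).
Proof.
pose topologies (f : dual X) : Topological X :=
  Topological.on (initial_topology (sval f : X -> (scalars R k)^o)).
move=> y.
apply: (@cvg_trans _ _ _ _ _ (@initial_continuous _ _ (sval g) y)).
have h := (@cvg_sup _ _ topologies (nbhs (y : weak_topology X)) y _).1 cvg_id g.
by move=> A /h.
Qed.

(** If s were at positive distance from the span, the Hahn-Banach functional
    that equals this distance at s and vanishes on the span would be weakly
    continuous, and would separate s from the sequence u. *)
Lemma weak_limit_in_span (u : nat -> X) (s : X) :
  (forall n, exists l, u n = combination l) ->
  (u : nat -> weak_topology X) @ \oo --> (s : weak_topology X) ->
  closure (range rational_combination) s.
Proof.
move=> uspan us; apply: contrapT => ns.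
have [e e0 se] : exists2 e : R, 0 < e &
    forall n, e <= rnorm (s - rational_combination n).
  apply: contrapT => H; apply: ns => B /nbhs_ballP[e /= e0 eB].
  have [a ea] := real_scalar_surj (ltW e0).
  have a0 : 0 < a by rewrite -(@real_scalar_lt R k) real_scalar0 -ea.
  have [n sn] : exists n, rnorm (s - rational_combination n) < a.
    apply: contrapT => H'; apply: H; exists a => // n.
    by rewrite leNgt; apply/negP => h; apply: H'; exists n.
  exists (rational_combination n); split; first by exists n.
  by apply: eB; rewrite -ball_normE /= -rnormE ea real_scalar_lt.
have [f [fp fs]] :=
  @hahn_banach R (real_module X) span_dist s span_dist_sublinear.
have f0 l : f (combination l) <= 0.
  apply: le_trans (fp _) _; apply: le_trans (span_dist_le _ l) _.
  by rewrite subrr -(scale0r 0) -(real_scalar0 R k) rnormZ normr0 mul0r.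
have fN v : f (- (v : X)) = - f v by exact: linearN.
have f00 l : f (combination l) = 0.
  apply/eqP; rewrite eq_le f0/= -oppr_le0 -fN -scaleN1r.
  by rewrite -(real_scalar1 R k) -real_scalarN combinationZ.
have fle v : f v <= rnorm v.
  apply: le_trans (fp _) _; apply: le_trans (span_dist_le _ [::]) _.
  by rewrite /combination big_nil subr0.
have fnorm v : `|f v| <= rnorm v.
  by rewrite ler_norml fle andbT lerNl -fN -rnormN.
have [g gf] := real_functional_dual fnorm.
have e20 : 0 < e / 2 by rewrite divr_gt0.
have sd : e / 2 <= span_dist s.
  apply: le_span_dist => l.
  have [n ln] := rational_approximation l e20.
  have := se n; rewrite -(subrK (combination l) s) -addrA.
  by move=> /le_trans/(_ (rnormD _ _)); rewrite subrK; lra.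
have gu : (sval g \o u) @ \oo --> sval g s.
  exact: (cvg_comp _ _ us (dual_weak_continuous (g := g) (x := s))).
have re0 : 0 < rs (e / 2) by rewrite -(real_scalar0 R k) real_scalar_lt.
have /cvgrPdist_lt/(_ _ re0)[n _ /(_ n (leqnn n))] := gu.
rewrite /= -linearB => /(le_lt_trans (gf _)); rewrite real_scalar_lt.
have [l ul] := uspan n.
have -> : f (s - u n) = f s - f (u n) by exact: linearB.
rewrite ul f00 subr0 fs ltNge => /negP; apply.
by apply: le_trans sd _; exact: ler_norm.
Qed.

End real_span.

(** * Admissible topologies and random signs *)

Lemma cvg_succ (T : topologicalType) (u : nat -> T) (s : T) :
  (fun n => u n.+1) @ \oo --> s <-> u @ \oo --> s.
Proof.
split=> us A /us [N _ NA].
  by exists N.+1 => // -[//|n] /= Nn; exact: NA.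
by exists N => // n /= Nn; apply: NA => /=; exact: leqW.
Qed.

Lemma not_diverges_cvg (K : numFieldType) (X : completeNormedModType K)
    (archK : forall e : K, 0 < e -> exists n, n.+1%:R^-1 < e)
    (x : nat -> X) (b : sign_seq) :
  ~ diverges x b <-> exists s : X, (psum x b : nat -> X) @ \oo --> s.
Proof.
split=> [nb|[s bs] [j _ jb]].
  suff : cvg ((psum x b : nat -> X) @ \oo).
    by move=> h; exists (lim ((psum x b : nat -> X) @ \oo)).
  apply: cauchy_cvg; apply: cauchy_exP => e e0; have [j je] := archK e e0.
  have [N HN] : exists N, forall n, (N <= n)%N ->
      `|psum x b n - psum x b N| <= j.+1%:R^-1.
    apply: contrapT => H; apply: nb; exists j => // N _.
    apply: contrapT => H'; apply: H; exists N => n Nn.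
    by apply: contrapT => H; apply: H'; exists n.
  exists (psum x b N); exists N => // n /= Nn; rewrite -ball_normE /= distrC.
  exact: le_lt_trans (HN _ Nn) je.
have j0 : (0 : K) < j.+1%:R^-1 / 2 by rewrite divr_gt0// invr_gt0 ltr0n.
have /cvgrPdist_lt/(_ _ j0)[N _ HN] := bs.
have [n Nn] := jb N I; apply.
rewrite -(subrK s (psum x b n)) -addrA (le_trans (ler_normD _ _))//.
rewrite (splitr j.+1%:R^-1) lerD//; last exact: ltW (HN _ (leqnn N)).
by rewrite distrC; exact: ltW (HN _ Nn).
Qed.

Section admissible.
Context (R : realType) (k : scalar_kind)
  (X : completeNormedModType (scalars R k))
  (tau : topology_on X) (tau_adm : admissible tau) (x : nat -> X).
Local Notation Xtau := (retopologize tau).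

Lemma psum_combination b n :
  psum x b n = combination x [seq ((-1) ^+ b i, i) | i <- iota 0 n].
Proof.
rewrite /psum /combination big_map /index_iota subn0; apply: eq_bigr => i _ /=.
by case: (b i); rewrite ?expr0 ?expr1 ?real_scalarN real_scalar1.
Qed.

(** A dense sequence will do if X is separable. Otherwise tau refines the weak
    topology, and the rational combinations of the x_n will do; this is the only
    use of that requirement on tau. Real scalars suffice for them, the signs
    being real. *)
Lemma separable_hull : exists D : nat -> X, forall b N (s : X),
  (fun n => psum x b n - psum x b N : Xtau) @ \oo --> (s : Xtau) ->
  closure (range D) s.
Proof.
case: tau_adm => _ _ _ _ weak.
have [[D cD dD]|nsep] := pselect (separable X).
  have [D0|[f]] := pfcard_geP cD.
    have [z []] := dD setT (ex_intro _ 0 I) openT; by rewrite D0.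
  exists f => b N s _ B nB.
  have [z [Bz Dz]] := dD B^° (ex_intro _ s nB) (open_interior B).
  have [n _ fn] := @surj _ _ _ _ f z Dz.
  exists z; split; last exact: interior_subset.
  by exists n.
exists (rational_combination x) => b N s bs.
apply: (@weak_limit_in_span _ _ _ x (fun n => psum x b n - psum x b N)).
  move=> n; exists ([seq ((-1) ^+ b i, i) | i <- iota 0 n] ++
    [seq (-1 * p.1, p.2) | p <- [seq ((-1) ^+ b i, i) | i <- iota 0 N]]).
  rewrite -combinationD -combinationZ -!psum_combination.
  by rewrite real_scalarN real_scalar1 scaleN1r.
move=> A; rewrite nbhsE => -[B [oB Bs] BA]; apply: filterS BA _.
by apply: bs; apply: open_nbhs_nbhs; split => //; exact: (weak nsep).
Qed.

Lemma tau_summable_null (mu : probability sign_seq R) : fair mu ->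
  full mu [set b | exists s, sums_to tau x b s] -> mu (diverges x) = 0%E.
Proof.
case: (tau_adm) => _ tvs weaker ball _ fmu fullmu.
have [D hull] := separable_hull.
exact: (null_diverges (@scalars_archi R k) tvs weaker ball hull fmu fullmu).
Qed.

Lemma norm_sums_to b (s : X) :
  (psum x b : nat -> X) @ \oo --> s -> sums_to tau x b s.
Proof.
case: (tau_adm) => _ _ weaker _ _ bs A; rewrite nbhsE => -[B [oB Bs] BA].
apply: filterS BA _; apply: bs; apply: open_nbhs_nbhs; split => //.
exact: weaker.
Qed.

End admissible.

Section random_signs.
Context (R : realType) (k : scalar_kind)
  (X : completeNormedModType (scalars R k))
  (x : nat -> X).
Context (d : measure_display) (Om : measurableType d) (P : probability Om R)
    (gamma : nat -> {RV P >-> R}).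
Hypothesis gamma_sign : forall n w, gamma n w = -1 \/ gamma n w = 1.
Hypothesis gamma_indep : independent_rvs P gamma.
Hypothesis gamma_sym : forall n, symmetric_rv P (gamma n).

Lemma signed_sum_psum w N :
  \sum_(0 <= n < N) real_scalar k (gamma n w) *: x n = psum x (bits gamma w) N.
Proof.
apply: eq_bigr => n _; rewrite (gamma_bits gamma_sign).
by case: (bits gamma w n); rewrite ?expr0 ?expr1 ?real_scalarN real_scalar1.
Qed.

Lemma norm_summableE w :
  summable_series (fun n => real_scalar k (gamma n w) *: x n) <->
  ~ diverges x (bits gamma w).
Proof.
rewrite (not_diverges_cvg (@scalars_archi R k)); rewrite /summable_series.
under eq_exists do under eq_fun do rewrite signed_sum_psum.
split => -[s xs]; exists s; first exact: (cvg_succ (T := X) _ _).1.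
exact: (cvg_succ (T := X) _ _).2.
Qed.

Lemma tau_summableE (tau : topology_on X) w :
  summable_series (E := retopologize tau)
    (fun n => real_scalar k (gamma n w) *: x n) <->
  exists s, sums_to tau x (bits gamma w) s.
Proof.
rewrite /summable_series.
have E : (fun N => \sum_(0 <= n < N.+1)
      (real_scalar k (gamma n w) *: x n : retopologize tau)) =
    (fun N => psum x (bits gamma w) N.+1 : retopologize tau).
  by apply/funext => N; exact: signed_sum_psum.
rewrite E; split => -[s xs]; exists s.
  exact: (cvg_succ (T := retopologize tau) _ _).1.
exact: (cvg_succ (T := retopologize tau) _ _).2.
Qed.

(** As the set of norm divergence is measurable in the signs, their law decides
    whether the series is almost surely norm summable. *)
Lemma ae_norm_summable_mu (mu : probability sign_seq R) :
  (forall A, measurable A -> mu A = P (bits gamma @^-1` A)) ->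
  ae_summable P gamma (x : nat -> X) <-> mu (diverges x) = 0%E.
Proof.
move=> muE; have md := measurable_diverges x.
have mbd : measurable (bits gamma @^-1` diverges x).
  by rewrite -[X in measurable X]setTI; exact: (measurable_bits gamma_sign).
rewrite muE//; split.
  move=> ae; apply/negligibleP => //; apply: negligibleS ae => w /= dw.
  by rewrite norm_summableE.
move=> P0; exists (bits gamma @^-1` diverges x); split => // w /=.
by rewrite norm_summableE => /contrapT.
Qed.

(** A measurable set of sign sequences without tau-summable members is met
    with probability zero, whatever the sample space looks like. *)
Lemma ae_tau_summable_full (tau : topology_on X) (mu : probability sign_seq R) :
  (forall A, measurable A -> mu A = P (bits gamma @^-1` A)) ->
  ae_summable P gamma (x : nat -> retopologize tau) ->
  full mu [set b | exists s, sums_to tau x b s].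
Proof.
move=> muE ae M mM MA; rewrite muE//; apply/negligibleP.
  by rewrite -[X in measurable X]setTI; exact: (measurable_bits gamma_sign).
by apply: negligibleS ae => w /= Mw /tau_summableE /MA.
Qed.

Lemma norm_tau_summable (tau : topology_on X) : admissible tau ->
  ae_summable P gamma (x : nat -> X) <->
  ae_summable P gamma (x : nat -> retopologize tau).
Proof.
move=> tau_adm; split.
  apply: filterS => w; rewrite norm_summableE.
  move/(not_diverges_cvg (@scalars_archi R k)) => [s bs]; apply/tau_summableE.
  by exists s; exact: norm_sums_to.
have [mu [fmu muE]] := fair_law_of_bits gamma_sign gamma_indep gamma_sym.
move=> /(ae_tau_summable_full muE) /(tau_summable_null tau_adm fmu).
by move/(ae_norm_summable_mu muE).
Qed.

End random_signs.

Theorem theorem1p3 (R : realType) (k : scalar_kind)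
    (X : completeNormedModType (scalars R k))
    (tau : topology_on X) (tau_adm : admissible tau)
    (d : measure_display) (Om : measurableType d) (P : probability Om R)
    (gamma : nat -> {RV P >-> R})
    (gamma_sign : forall n w, gamma n w = -1 \/ gamma n w = 1)
    (gamma_indep : independent_rvs P gamma)
    (gamma_sym : forall n, symmetric_rv P (gamma n))
    (x : nat -> X) :
  (ae_summable P gamma (x : nat -> X) <->
   ae_summable P gamma (x : nat -> retopologize tau)) /\
  (forall (tau' : topology_on X) (tau'_adm : admissible tau')
      (d' : measure_display) (Om' : measurableType d')
      (P' : probability Om' R) (gamma' : nat -> {RV P' >-> R})
      (gamma'_sign : forall n w, gamma' n w = -1 \/ gamma' n w = 1)
      (gamma'_indep : independent_rvs P' gamma')
      (gamma'_sym : forall n, symmetric_rv P' (gamma' n))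
      (gamma'_law : forall n, same_law P (gamma n) P' (gamma' n)),
    (ae_summable P gamma (x : nat -> X) <->
     ae_summable P' gamma' (x : nat -> X)) /\
    (ae_summable P gamma (x : nat -> retopologize tau) <->
     ae_summable P' gamma' (x : nat -> retopologize tau'))).
Proof.
split; first exact: norm_tau_summable.
move=> tau' tau'_adm d' Om' P' gamma' gamma'_sign gamma'_indep gamma'_sym _.
have [mu [mu_fair muE]] := fair_law_of_bits gamma_sign gamma_indep gamma_sym.
have [mu' [mu'_fair mu'E]] :=
  fair_law_of_bits gamma'_sign gamma'_indep gamma'_sym.
have norm_law : ae_summable P gamma (x : nat -> X) <->
    ae_summable P' gamma' (x : nat -> X).
  rewrite (ae_norm_summable_mu x gamma_sign muE).
  rewrite (ae_norm_summable_mu x gamma'_sign mu'E).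
  by rewrite (fair_unique mu_fair mu'_fair (measurable_diverges x)).
split => //.
rewrite -(norm_tau_summable x gamma_sign gamma_indep gamma_sym tau_adm).
by rewrite -(norm_tau_summable x gamma'_sign gamma'_indep gamma'_sym tau'_adm).
Qed.
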